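(* Let $V$ and $W_1,\dots,W_J$ be real Hilbert spaces, $B_j\colon V\to W_j$ bounded linear operators, $G_j\colon W_j\to\overline{\mathbb{R}}$ proper, convex, and lower semicontinuous functions ($1\le j\le J$), and $F\colon V\to\mathbb{R}$ a Fr\'echet differentiable convex function that is strongly convex and smooth. Let $\tau>0$. Consider the primal problem $$\min_{v\in V}\Big\{F(v)+\sum_{j=1}^JG_j(B_jv)\Big\}\qquad(\mathrm{P})$$ and its dual problem $$\min_{q_j\in W_j^*}\Big\{F^*\Big(-\sum_{j=1}^JB_j^*q_j\Big)+\sum_{j=1}^JG_j^*(q_j)\Big\}.\qquad(\mathrm{D})$$ The parallel Douglas--Rachford splitting algorithm for (P): choose $u^{(0)}\in V$ and $(r_1^{(0)},\dots,r_J^{(0)})\in(V^* )^J$, and for $n=0,1,2,\dots$ set, for each $1\le j\le J$ (in parallel), $$\hat{u}_j^{(n+1)}=\arg\min_{v\in V}\Big\{D_F(v;u^{(n)})+(r_j^{(n)},v)+G_j(B_jv)\Big\},$$ $$r_j^{(n+1)}=r_j^{(n)}+\tau\big(F'(\hat{u}_j^{(n+1)})-F'(u^{(n)})\big),$$ and then $$u^{(n+1)}=(F^* )'\Big(\sum_{j=1}^Jr_j^{(n+1)}\Big),$$ is a dualization of the parallel subspace correction method (PSC) for (D): choose $(p_1^{(0)},\dots,p_J^{(0)})\in\prod_{j=1}^JW_j^*$, and for $n=0,1,2,\dots$ take, for each $1\le j\le J$, $$\hat{p}_j^{(n+1)}\in\arg\min_{q_j\in W_j^*}\Big\{F^*\Big(-B_j^*q_j-\sum_{i\ne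 j}B_i^*p_i^{(n)}\Big)+G_j^*(q_j)\Big\},$$ and then $p_j^{(n+1)}=(1-\tau)p_j^{(n)}+\tau\hat{p}_j^{(n+1)}$, $1\le j\le J$. More precisely, if $$u^{(0)}=(F^* )'\Big(-\sum_{j=1}^JB_j^*p_j^{(0)}\Big),\quad r_j^{(0)}=-B_j^*p_j^{(0)},\quad 1\le j\le J,$$ then $$u^{(n)}=(F^* )'\Big(-\sum_{j=1}^JB_j^*p_j^{(n)}\Big),\quad r_j^{(n)}=-B_j^*p_j^{(n)},\quad 1\le j\le J,\ n\ge1.$$
   Context: Notation: $\overline{\mathbb{R}}=\mathbb{R}\cup\{\pm\infty\}$; $V^*$, $W_j^*$ are dual spaces; $(\cdot,\cdot)$ denotes inner products and duality pairings; $B_j^*\colon W_j^*\to V^*$ is the adjoint. The conjugate is $F^*(q)=\sup_{v\in V}\{(q,v)-F(v)\}$, $q\in V^*$; similarly $G_j^*$ on $W_j^*$. The Bregman divergence is $D_F(v;w)=F(v)-F(w)-(F'(w),v-w)$. $F$ strongly convex: for some $\mu>0$, $F(v)\ge F(w)+(F'(w),v-w)+\frac{\mu}{2}\|v-w\|^2$ for all $v,w\in V$. $F$ smooth: for some $L>0$, $\|F'(v)-F'(w)\|\le L\|v-w\|$ for all $v,w\in V$. Under these assumptions $F'\colon V\to V^*$ is invertible with inverse $(F^* )'\colon V^*\to V$. Dualization (definition): a method $\{u^{(n)}\}$ for (P) is a dualization of a method $\{(p_1^{(n)},\dots,p_J^{(n)})\}$ for (D) if, for any initial configuration of the dual algorithm,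 there exists an initial configuration of the primal algorithm such that $-\sum_{j=1}^JB_j^*p_j^{(n)}\in\partial F(u^{(n)})=\{F'(u^{(n)})\}$ for all $n\ge1$. Standing assumptions: every minimization subproblem defining an iterate through an $\arg\min$ admits a solution; and whenever Fenchel--Rockafellar duality is used (for (P)/(D) and for the corresponding pairs of local subproblems), the strong duality qualification condition holds: for a problem $\min_{v}\{\Phi(v)+\Gamma(Bv)\}$, the function $w\mapsto\inf_{v}\{\Phi(v)+\Gamma(Bv+w)\}$ is subdifferentiable (has nonempty subdifferential) at $w=0$. *)

(* Defs.v *)
From HB Require Import structures.
From mathcomp Require Import all_boot all_order all_algebra sesquilinear.
From mathcomp Require Import all_classical all_reals all_analysis.

Set Implicit Arguments.
Unset Strict Implicit.
Unset Printing Implicit Defensive.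
Import Order.TTheory GRing.Theory Num.Theory.
Import numFieldNormedType.Exports.
Local Open Scope classical_set_scope.
Local Open Scope ring_scope.

HB.mixin Record CompleteNormedModule_isHilbert (R : realType) V
    & CompleteNormedModule R V := {
  inner : {dot V for (@idfun R)} ;
  sqr_norm_inner : forall x : V, `|x| ^+ 2 = inner x x
}.

#[short(type="hilbertType")]
HB.structure Definition Hilbert (R : realType) :=
  {V of CompleteNormedModule R V & CompleteNormedModule_isHilbert R V}.

(* The topological dual, with the operator norm. *)
Section dual.
Context {R : realType} (V : normedModType R).

Definition continuous_linear : {pred V -> R^o} :=
  [pred f | `[< linear f /\ continuous f >]].

Record dual := Dual {
  dual_fun :> V -> R^o;
  dual_funP : dual_fun \in continuous_linear }.

HB.instance Definition _ := [isSub for dual_fun].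
HB.instance Definition _ := [Choice of dual by <:].

Fact continuous_linear_submod : submod_closed continuous_linear.
Proof.
split.
  apply/asboolP; split; last exact: cst_continuous.
  by move=> a u v; rewrite /GRing.zero /= scaler0 addr0.
move=> a f g /asboolP[lf cf] /asboolP[lg cg]; apply/asboolP; split.
  move=> b u v.
  have E (h k : V -> R^o) x : (a *: h + k) x = a *: h x + k x by [].
  by rewrite !E lf lg !scalerDr !scalerA [a * b]mulrC addrACA.
by move=> x; apply: cvgD; [apply: cvgZr; exact: cf|exact: cg].
Qed.

HB.instance Definition _ := GRing.isSubmodClosed.Build R _ continuous_linear
  continuous_linear_submod.
HB.instance Definition _ := [SubChoice_isSubLmodule of dual by <:].

Fact dual_linear (q : dual) : linear q.
Proof. by have /asboolP[] := dual_funP q. Qed.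

Fact dual_continuous (q : dual) : continuous q.
Proof. by have /asboolP[] := dual_funP q. Qed.

HB.instance Definition _ (q : dual) :=
  GRing.isLinear.Build R V R^o *:%R q (@dual_linear q).

Definition opnorm (q : dual) : R := sup [set `|q x| | x in [set x | `|x| <= 1]].

Fact opnorm_has_sup (q : dual) :
  has_sup [set `|q x| | x in [set x | `|x| <= 1]].
Proof.
split; first by exists `|q 0|, 0 => //=; rewrite normr0 ler01.
have /linear_bounded_continuous/bounded_funP/(_ 1)[M qM] :=
  @dual_continuous q.
by exists M => _ [x /= x1 <-]; exact: qM.
Qed.

Fact opnorm_le (q : dual) x : `|q x| <= opnorm q * `|x|.
Proof.
have [->|x0] := eqVneq x 0; first by rewrite linear0 !normr0 mulr0.
have nx0 : 0 < `|x| by rewrite normr_gt0.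
rewrite -ler_pdivrMr//; apply: ub_le_sup; first by case: (opnorm_has_sup q).
exists (`|x|^-1 *: x) => /=.
  by rewrite normrZ normfV normr_id mulVf// gt_eqF.
by rewrite linearZ normrZ normfV normr_id mulrC.
Qed.

Fact opnorm_lub (q : dual) M :
  0 <= M -> (forall x, `|q x| <= M * `|x|) -> opnorm q <= M.
Proof.
move=> M0 qM; apply: ge_sup; first by case: (opnorm_has_sup q).
by move=> _ [x /= x1 <-]; rewrite (le_trans (qM x))// ler_piMr.
Qed.

Fact opnorm_ge0 (q : dual) : 0 <= opnorm q.
Proof.
rewrite (@le_trans _ _ `|q 0|)//; apply: ub_le_sup.
  by case: (opnorm_has_sup q).
by exists 0 => //=; rewrite normr0 ler01.
Qed.

Fact ler_opnormD (p q : dual) : opnorm (p + q) <= opnorm p + opnorm q.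
Proof.
apply: opnorm_lub => [|x]; first by rewrite addr_ge0 ?opnorm_ge0.
by rewrite mulrDl (le_trans (ler_normD _ _))// lerD ?opnorm_le.
Qed.

Fact opnormZ (a : R) (q : dual) : opnorm (a *: q) = `|a| * opnorm q.
Proof.
have le b (p : dual) : opnorm (b *: p) <= `|b| * opnorm p.
  apply: opnorm_lub => [|x]; first by rewrite mulr_ge0 ?opnorm_ge0.
  by rewrite normrZ -mulrA ler_wpM2l ?opnorm_le.
apply/le_anti; rewrite le//=.
have [->|a0] := eqVneq a 0; first by rewrite normr0 mul0r opnorm_ge0.
rewrite -ler_pdivlMl ?normr_gt0// -normfV.
by rewrite (le_trans _ (le a^-1 _))// scalerA mulVf// scale1r.
Qed.

Fact opnorm0_eq0 (q : dual) : opnorm q = 0 -> q = 0.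
Proof.
move=> q0; apply/val_inj/funext => x /=.
by apply/eqP; rewrite -normr_le0 (le_trans (opnorm_le q x))// q0 mul0r.
Qed.

HB.instance Definition _ :=
  Lmodule_isNormed.Build R dual ler_opnormD opnormZ opnorm0_eq0.
End dual.
Arguments continuous_linear {R} V _ : simpl never.

Record bounded_op {R : realType} (V W : normedModType R) := BoundedOp {
  op_fun :> {linear V -> W};
  op_bounded : bounded_near op_fun (nbhs (0 : V)) }.

Section adjoint.
Context {R : realType} {V W : normedModType R} (B : bounded_op V W).

Fact adjoint_subproof (q : dual W) :
  (q \o B : V -> R^o) \in continuous_linear V.
Proof.
apply/asboolP; split; first by move=> a u v; rewrite /= !linearP.
move=> x; apply: continuous_comp; last exact: dual_continuous.
exact: (bounded_linear_continuous (op_bounded B)).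
Qed.

Definition adjoint (q : dual W) : dual V := Dual (adjoint_subproof q).
End adjoint.

Section convex_analysis.
Context {R : realType} {V : normedModType R}.
Implicit Types (f : V -> \bar R) (F : V -> R).

Definition proper_function f :=
  (forall v, f v != -oo%E) /\ (exists v, (f v < +oo)%E).

Definition ereal_convex f := forall (t : R) (v w : V), 0 <= t <= 1 ->
  (f (t *: v + (1 - t) *: w)%R <= t%:E * f v + (1 - t)%:E * f w)%E.

Definition argmin {X : Type} (f : X -> \bar R) : set X :=
  [set x | forall y, (f x <= f y)%E].

Definition conjugate f (q : dual V) : \bar R :=
  ereal_sup (range (fun v => ((q v)%:E - f v)%E)).

Definition subdifferential f (v : V) : set (dual V) :=
  [set q : dual V | f v \is a fin_num /\
    forall w : V, (f v + (q (w - v)%R)%:E <= f w)%E].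

(* The derivative F'(v) as an element of the dual. *)
Definition grad F (v : V) : dual V := get [set q : dual V | is_diff v F q].

(* The derivative of F^* at q, identified with an element of V through the
   canonical embedding of V into its bidual. *)
Definition grad_conjugate F (q : dual V) : V :=
  get [set u : V | is_diff q (fine \o conjugate (EFin \o F))
                             (fun p : dual V => p u)].

Definition bregman F (v w : V) : R := F v - F w - grad F w (v - w).

Definition strongly_convex F := exists2 mu : R, 0 < mu &
  forall v w, F v >= F w + grad F w (v - w) + mu / 2 * `|v - w| ^+ 2.

Definition smooth F := exists2 L : R, 0 < L &
  forall v w, `|grad F v - grad F w| <= L * `|v - w|.

End convex_analysis.

Section strong_duality.
Context {R : realType} {V : normedModType R}.
Local Open Scope ereal_scope.

Definition perturbation {W : normedModType R} (Phi : V -> R)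
    (Gamma : W -> \bar R) (B : V -> W) (w : W) : \bar R :=
  ereal_inf (range (fun v => (Phi v)%:E + Gamma (B v + w)%R)).

Definition qualified {W : normedModType R} (Phi : V -> R)
    (Gamma : W -> \bar R) (B : V -> W) :=
  subdifferential (perturbation Phi Gamma B) 0%R !=set0.

(* The same two notions for B = (B_1, ..., B_J), with values in the product of
   the W_j, and Gamma (w_1, ..., w_J) = G_1 w_1 + ... + G_J w_J; the dual of
   the product is the product of the duals. *)
Context {J : nat} {W : 'I_J -> normedModType R}.

Definition perturbation_prod (F : V -> R) (G : forall j, W j -> \bar R)
    (B : forall j, V -> W j) (w : forall j, W j) : \bar R :=
  ereal_inf (range (fun v => (F v)%:E + \sum_(j < J) G j (B j v + w j)%R)).

Definition qualified_prod (F : V -> R) (G : forall j, W j -> \bar R)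
    (B : forall j, V -> W j) :=
  let h := perturbation_prod F G B in
  let w0 := fun j => 0%R : W j in
  exists p : forall j, dual (W j), h w0 \is a fin_num /\
    forall w, h w0 + (\sum_(j < J) p j (w j))%:E <= h w.

End strong_duality.

Section algorithms.
Context {R : realType} {V : hilbertType R} {J : nat} {W : 'I_J -> hilbertType R}.
Variables (F : V -> R) (G : forall j, W j -> \bar R).
Variable B : forall j, bounded_op V (W j).
Variable tau : R.

Definition dr_local_smooth (u : V) (r : dual V) (v : V) : R :=
  bregman F v u + r v.

Definition dr_local (j : 'I_J) (u : V) (r : dual V) (v : V) : \bar R :=
  ((dr_local_smooth u r v)%:E + G (B j v))%E.

Definition parallel_DR (u : nat -> V) (r : nat -> 'I_J -> dual V) :=
  forall n,
    (forall j, exists2 uhat, argmin (dr_local j (u n) (r n j)) uhat &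
      r n.+1 j = r n j + tau *: (grad F uhat - grad F (u n))) /\
    u n.+1 = grad_conjugate F (\sum_(j < J) r n.+1 j).

Definition psc_local (p : forall j, dual (W j)) (j : 'I_J) (q : dual (W j)) :
    \bar R :=
  (conjugate (EFin \o F)
     (- adjoint (B j) q - \sum_(i < J | i != j) adjoint (B i) (p i))%R
   + conjugate (@G j) q)%E.

Definition parallel_SC (p : nat -> forall j, dual (W j)) :=
  forall n j, exists2 phat, argmin (psc_local (p n) (j := j)) phat &
    p n.+1 j = (1 - tau) *: p n j + tau *: phat.

(* A method is given by the relation between its initial configurations and
   the sequences it generates.  As the initial configuration of the primal
   method is existentially quantified, it is required to generate at least one
   sequence. *)
Definition dualization {C : Type} (primal : C -> set (nat -> V))
    (dual_method : (forall j, dual (W j)) -> set (nat -> forall j, dual (W j))) :=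
  forall p0, exists c, primal c !=set0 /\
    forall p u, dual_method p0 p -> primal c u -> forall n, (0 < n)%N ->
      subdifferential (EFin \o F) (u n) (- \sum_(j < J) adjoint (B j) (p n j)).

Definition DR_method (c : V * ('I_J -> dual V)) : set (nat -> V) :=
  [set u | exists r, [/\ u 0%N = c.1, r 0%N = c.2 & parallel_DR u r]].

Definition PSC_method (p0 : forall j, dual (W j)) :
    set (nat -> forall j, dual (W j)) :=
  [set p | p 0%N = p0 /\ parallel_SC p].

End algorithms.
Arguments psc_local {R V J W} F G B p j q.

(* Main.v *)
From HB Require Import structures.
Require Import Defs.
From mathcomp Require Import all_boot all_order all_algebra.
From mathcomp Require Import all_classical all_reals all_analysis.
From mathcomp Require Import ring lra.
Import Order.TTheory GRing.Theory Num.Theory.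
Import numFieldNormedType.Exports.
Local Open Scope classical_set_scope.
Local Open Scope ring_scope.

(** The two algorithms are carried into each other, step by step, by the map
    that sends a dual configuration p to u = (F^* )'(- sum_j B_j^* p_j) and
    r_j = - B_j^* p_j.  Once it is known that F' and (F^* )' are inverse to each
    other, everything rests on one local fact.

    Suppose that u and r come from p and put s = sum_(i != j) B_i^* p_i.  Then
    r_j - F'(u) = s, so up to an additive constant the smooth part of the primal
    subproblem is v |-> F v + s v.  The Fenchel-Rockafellar dual of minimizing
    F v + s v + G_j (B_j v) is exactly the subspace problem: minimize
    F^*(- B_j^* q - s) + G_j^*(q).  Strong duality says that the two optimal
    values are opposite.  It follows that every dual minimizer phat and every
    primal minimizer uhat satisfy the optimality relation
    F'(uhat) = - B_j^* phat - s (lemma [grad_primal_dual]).  Subtracting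
    F'(u) = - B_j^* p_j - s leaves F'(uhat) - F'(u) = B_j^* p_j - B_j^* phat, and
    the update of r_j with step tau is minus B_j^* applied to the relaxed update
    of p_j.  Summing over j gives the update of u.

    The inversion of F' goes as follows.  By strong convexity, for each q in
    the dual space, a minimizing sequence of F - q is a Cauchy sequence, so
    F - q has a minimizer x ([argmin_sub]); as F' is Lipschitz continuous,
    F'(x) = q ([grad_surjective]).  Strong convexity also yields
    0 <= F^*(p) - F^*(q) - (p - q)(x) <= |p - q|^2 / (2 mu), hence F^* is
    differentiable at q = F'(x) with derivative the evaluation at x
    ([is_diff_conjugate]), that is (F^* )'(F'(x)) = x ([grad_conjugateK]). *)

(** * Linear functionals and differentials *)

Section dual_facts.
Context {R : realType} {V W : normedModType R}.
Implicit Types (p q : dual V) (x : V).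

Lemma dualD p q x : (p + q) x = p x + q x. Proof. by []. Qed.
Lemma dualN p x : (- p) x = - p x. Proof. by []. Qed.

(** The rules [linearD], [linearN] and [linearZ] have their right-hand sides in
    the regular module R^o; stated in R, they combine with field arithmetic. *)
Lemma dual_addr p x y : p (x + y) = p x + p y :> R.
Proof. exact: linearD. Qed.
Lemma dual_oppr p x : p (- x) = - p x :> R.
Proof. exact: linearN. Qed.
Lemma dual_scaler p a x : p (a *: x) = a * p x :> R.
Proof. exact: linearZ. Qed.

Lemma dual_normr_le p x : `|p x| <= `|p| * `|x|.
Proof. exact: opnorm_le. Qed.

Lemma dual_le p x : p x <= `|p| * `|x|.
Proof. exact: le_trans (ler_norm _) (dual_normr_le _ _). Qed.

Lemma dual_eq0 p : (forall x, p x <= 0) -> p = 0.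
Proof.
move=> p0; apply/val_inj/funext => x /=; apply/le_anti; rewrite p0 /=.
by have := p0 (- x); rewrite linearN oppr_le0.
Qed.

Lemma adjointD (B : bounded_op V W) (p q : dual W) :
  adjoint B (p + q) = adjoint B p + adjoint B q.
Proof. exact/val_inj. Qed.

Lemma adjointZ (B : bounded_op V W) a (p : dual W) :
  adjoint B (a *: p) = a *: adjoint B p.
Proof. exact/val_inj. Qed.

Definition evaluation x : dual V -> R := fun p => p x.

Lemma evaluation_linear x : linear (evaluation x : dual V -> R^o).
Proof. by move=> a p q. Qed.

HB.instance Definition _ x :=
  GRing.isLinear.Build R (dual V) R^o *:%R (evaluation x) (evaluation_linear x).

Lemma evaluation_continuous x : continuous (evaluation x : dual V -> R^o).
Proof.
apply: bounded_linear_continuous; apply/linear_boundedP.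
exists `|x|; split => // M xM p.
by rewrite (le_trans (dual_normr_le p x))// mulrC ler_wpM2r// ltW.
Qed.

End dual_facts.

Lemma is_diff_quadratic {R : realType} {V : normedModType R} (f : V -> R)
    (df : {linear V -> R}) (x : V) (K : R) : continuous df -> 0 < K ->
  (forall y, `|f y - f x - df (y - x)| <= K * `|y - x| ^+ 2) ->
  is_diff x f df.
Proof.
move=> dfc K0 fK.
have E : f \o shift x = cst (f x) + df +o_ 0 id.
  apply/eqaddoP => _/posnumP[e]; near=> h.
  have := fK (h + x); rewrite addrK => /le_trans.
  rewrite /(cst _ + _) /= opprD addrA; apply.
  rewrite expr2 mulrA ler_wpM2r// -ler_pdivlMl//.
  by near: h; apply: nbhs0_le; rewrite mulr_gt0 ?invr_gt0.
split; last exact: diff_unique.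
by apply/diff_locallyP; rewrite (diff_unique dfc E).
Unshelve. all: by end_near. Qed.

(** * Inverting the gradient of a strongly convex function *)

(** Completing the square in a - mu * b: this is where the constant
    1 / (2 mu) in the growth estimates below comes from. *)
Lemma young_le {R : realFieldType} (mu a b : R) : 0 < mu ->
  a * b - mu / 2 * b ^+ 2 <= a ^+ 2 / (2 * mu).
Proof.
move=> mu0; have -> : a ^+ 2 / (2 * mu) =
    a * b - mu / 2 * b ^+ 2 + (a - mu * b) ^+ 2 / (2 * mu).
  by field; rewrite gt_eqF.
by rewrite lerDl divr_ge0 ?sqr_ge0// mulr_ge0 // ltW.
Qed.

Section strongly_convex_function.
Context {R : realType} {V : completeNormedModType R} {F : V -> R}.
Hypothesis F_sc : strongly_convex F.
Implicit Types (q : dual V) (u v w x : V).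

Lemma subgradient_le u v : F u + grad F u (v - u) <= F v.
Proof.
have [mu mu0 F_ge] := F_sc; apply: le_trans (F_ge v u).
by rewrite lerDl mulr_ge0// ?divr_ge0 ?exprn_ge0// ltW.
Qed.

Lemma has_lbound_sub q : has_lbound (range (fun v => F v - q v)).
Proof.
have [mu mu0 F_ge] := F_sc.
exists (F 0 - `|grad F 0 - q| ^+ 2 / (2 * mu)) => _ [v _ <-].
have := F_ge v 0; rewrite subr0.
have := young_le _ `|grad F 0 - q| `|v| mu0.
have := dual_normr_le (grad F 0 - q) v.
by rewrite dualD dualN ler_norml => /andP[+ _]; lra.
Qed.

(** Comparing the values at x and y with the value at their midpoint, where
    the first-order terms cancel: two points at which F - q is close to its
    infimum are close to each other. *)
Lemma midpoint_ge q (mu : R) x y :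
  (forall v w, F v >= F w + grad F w (v - w) + mu / 2 * `|v - w| ^+ 2) ->
  2 * inf (range (fun v => F v - q v)) + mu / 4 * `|x - y| ^+ 2
  <= (F x - q x) + (F y - q y).
Proof.
move=> F_ge; set m := 2^-1 *: (x + y).
have half v : v = 2^-1 *: v + 2^-1 *: v.
  by rewrite -scalerDl [X in X *: _](_ : _ = 1) ?scale1r//; field.
have xm : x - m = 2^-1 *: (x - y).
  by rewrite {1}[x]half /m scalerDr addrKA scalerBr.
have ym : y - m = - (2^-1 *: (x - y)).
  rewrite {1}[y]half /m addrC scalerDr opprD addrACA addNr addr0.
  by rewrite scalerBr opprB addrC.
have := F_ge x m; have := F_ge y m.
rewrite xm ym dual_oppr normrN normrZ normfV normr_nat.
have : inf (range (fun v => F v - q v)) <= F m - q m.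
  by apply: ge_inf; [exact: has_lbound_sub | exists m].
have -> : q m = 2^-1 * (q x + q y) :> R by rewrite dual_scaler dual_addr.
by rewrite exprMn; lra.
Qed.

(** The limit x of a minimizing sequence u_n is a minimizer because the affine
    minorant of F at x makes F - q lower semicontinuous at x. *)
Lemma argmin_sub q : exists x, forall v, F x - q x <= F v - q v.
Proof.
have [mu mu0 F_ge] := F_sc.
pose H v := F v - q v; pose m := inf (range H).
have hm : has_inf (range H).
  by split; [exists (H 0), 0 | exact: has_lbound_sub].
have Hm v : m <= H v by apply: ge_inf; [exact: has_lbound_sub | exists v].
have /choice[u uP] n : exists v, H v < m + (n.+1%:R)^-1.
  have e0 : (0 : R) < (n.+1%:R)^-1 by rewrite invr_gt0 ltr0n.
  by have [_ [v _ <-] vm] := inf_adherent e0 hm; exists v.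
have inv0 (e : R) : 0 < e -> \forall n \near \oo, (n.+1%:R)^-1 < e :> R.
  by move=> e0; exact: near_infty_natSinv_lt (PosNum e0).
have cu : cvg (u @ \oo).
  apply/cauchy_cvgP/cauchy_exP => e e0.
  have d0 : 0 < mu / 8 * e ^+ 2 by rewrite mulr_gt0 ?exprn_gt0// divr_gt0.
  have [N _ NP] := inv0 _ d0.
  exists (u N); exists N => // n /= Nn.
  rewrite -ball_normE /=.
  have := midpoint_ge q _ (u N) (u n) F_ge; rewrite -/(H _) -/(H _) -/m.
  have := NP _ (leqnn N); have := NP n Nn; have := uP N; have := uP n.
  move=> /= h1 h2 h3 h4 h5.
  have : mu / 4 * `|u N - u n| ^+ 2 < mu / 4 * e ^+ 2.
    have -> : mu / 4 * e ^+ 2 = 2 * (mu / 8 * e ^+ 2) by field.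
    by move: (_.+1%:R^-1) (_.+1%:R^-1) h1 h2 h3 h4 h5 => a b; lra.
  by rewrite ltr_pM2l ?divr_gt0// ltr_pXn2r// nnegrE ?normr_ge0// ltW.
set x := lim (u @ \oo).
exists x => v; apply: le_trans (Hm v).
apply/ler_addgt0Pl => e e0.
have e2 : 0 < e / 2 by rewrite divr_gt0.
set a := `|grad F x - q| + 1.
have a0 : 0 < a by rewrite ltr_wpDl.
have ea : 0 < e / 2 / a by rewrite divr_gt0.
near \oo => n.
have un : H (u n) < m + e / 2.
  by apply: lt_trans (uP n) _; rewrite ltrD2l; near: n; exact: inv0.
have xn : `|x - u n| < e / 2 / a by near: n; move/cvgrPdist_lt: cu; exact.
have := subgradient_le x (u n).
have := dual_normr_le (grad F x - q) (u n - x).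
rewrite dualD dualN ler_norml => /andP[+ _] H1.
have H2 : `|grad F x - q| * `|u n - x| <= e / 2.
  rewrite [`|u n - x|]distrC; apply: le_trans (_ : a * `|x - u n| <= _).
    by rewrite ler_wpM2r// lerDl.
  by rewrite mulrC -ler_pdivlMr// ltW.
move: H1; rewrite [q (u n - x)]dual_addr dual_oppr.
by move: un; rewrite /H; lra.
Unshelve. all: by end_near. Qed.

(** With y = x + t d and t > 0, minimality of x and the affine minorant of F at
    y give q d <= F'(y) d, and the right-hand side tends to F'(x) d with t
    since F' is Lipschitz continuous; d being arbitrary, q = F'(x). *)
Lemma grad_surjective : smooth F -> forall q, exists x, grad F x = q.
Proof.
move=> [L _ FL] q; have [x xmin] := argmin_sub q.
exists x; apply/esym/eqP; rewrite -subr_eq0; apply/eqP/dual_eq0 => d.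
rewrite dualD dualN subr_le0.
have L0 : 0 <= L * `|d|.
  by have := le_trans (normr_ge0 _) (FL d 0); rewrite subr0.
apply/ler_addgt0Pl => e e0.
set K := L * `|d| * `|d| + 1.
have K0 : 0 < K by rewrite ltr_wpDl// mulr_ge0.
set t := e / K.
have t0 : 0 < t by rewrite divr_gt0.
have := xmin (x + t *: d); have := subgradient_le (x + t *: d) x.
have -> : x - (x + t *: d) = - (t *: d) by rewrite opprD addrA subrr add0r.
rewrite dual_oppr dual_addr dual_scaler dual_scaler => H1 H2.
have : t * q d <= t * grad F (x + t *: d) d by move: H1 H2; lra.
rewrite ler_pM2l// => /le_trans; apply.
rewrite -lerBlDr.
apply: le_trans (dual_le (grad F (x + t *: d) - grad F x) d) _.
apply: le_trans (_ : L * `|t *: d| * `|d| <= _).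
  by rewrite ler_wpM2r//; apply: le_trans (FL _ _) _; rewrite addrC addKr.
rewrite normrZ gtr0_norm//.
have -> : L * (t * `|d|) * `|d| = t * (L * `|d| * `|d|) by ring.
by rewrite /t -mulrA ger_pMr// ler_pdivrMl// mulr1 lerDl.
Qed.

Lemma conjugate_ge q v : ((q v - F v)%:E <= conjugate (EFin \o F) q)%E.
Proof. by apply: ereal_sup_ubound; exists v. Qed.

Lemma conjugate_grad u :
  conjugate (EFin \o F) (grad F u) = (grad F u u - F u)%:E.
Proof.
apply/le_anti/andP; split; last exact: conjugate_ge.
apply: ge_ereal_sup => _ [v _ <-] /=; rewrite -EFinB lee_fin.
by have := subgradient_le u v; rewrite dual_addr dual_oppr; lra.
Qed.

Hypothesis F_sm : smooth F.

(** A point p of the dual space is F'(w) for some w, so both conjugate values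
    are explicit, and the remainder F^*(p) - F^*(F'(u)) - (p - F'(u))(u) is the
    Bregman divergence F u - F w - F'(w)(u - w).  This is at least 0, and at
    most |p - F'(u)|^2 / (2 mu) by strong convexity at u and Young's
    inequality. *)
Lemma is_diff_conjugate u :
  is_diff (grad F u) (fine \o conjugate (EFin \o F)) (fun p : dual V => p u).
Proof.
have [mu mu0 F_ge] := F_sc.
apply: (@is_diff_quadratic _ _ _ (evaluation u) _ ((2 * mu)^-1)).
- exact: evaluation_continuous.
- by rewrite invr_gt0 mulr_gt0.
move=> p; have [w <-] := grad_surjective F_sm p.
rewrite /= !conjugate_grad /= -[X in `|_ - X|]/(grad F w u - grad F u u).
have := F_ge w u; have := subgradient_le w u.
have := young_le _ `|grad F w - grad F u| `|w - u| mu0.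
have := dual_le (grad F w - grad F u) (w - u).
rewrite !(dualD, dualN, dual_addr, dual_oppr) => h1 h2 h3 h4.
by rewrite ger0_norm; lra.
Qed.

(** The derivative of F^* determines its representative in V only through the
    values p v; strong convexity turns the equality of these values with the
    p u into v = u. *)
Lemma grad_conjugateK u : grad_conjugate F (grad F u) = u.
Proof.
have [mu mu0 F_ge] := F_sc.
have du : [set v | is_diff (grad F u) (fine \o conjugate (EFin \o F))
    (fun p : dual V => p v)] u by exact: is_diff_conjugate.
have := getPex (ex_intro _ u du).
rewrite -/(grad_conjugate F (grad F u)) /=.
set v := grad_conjugate _ _ => dv.
have E (p : dual V) : p v = p u.
  have := @diff_val _ _ _ _ _ _ _ du.
  by rewrite (@diff_val _ _ _ _ _ _ _ dv) => /(congr1 (@^~ p)).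
have := F_ge u v; have := F_ge v u.
rewrite !dual_addr !dual_oppr !E !subrr distrC => h1 h2.
apply/eqP; rewrite -subr_eq0 -normr_le0 -(@ler_pXn2r _ 2) ?nnegrE//.
by rewrite expr0n /= -(@ler_pM2l _ mu)// mulr0 distrC; lra.
Qed.

Lemma grad_conjugate_inv q : grad F (grad_conjugate F q) = q.
Proof.
by have [x <-] := grad_surjective F_sm q; rewrite grad_conjugateK.
Qed.

(** By surjectivity q = F'(w) for some w; then w is a minimizer too, and strong
    convexity leaves room for only one. *)
Lemma grad_minimizer q x : (forall v, F x - q x <= F v - q v) -> grad F x = q.
Proof.
have [mu mu0 F_ge] := F_sc.
have [w <-] := grad_surjective F_sm q => /(_ w) xmin.
suff -> : x = w by [].
apply/eqP; rewrite -subr_eq0 -normr_le0 -(@ler_pXn2r _ 2) ?nnegrE//.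
rewrite expr0n /= -(@ler_pM2l _ mu)// mulr0.
by have := F_ge x w; rewrite dual_addr dual_oppr; lra.
Qed.

(** * Duality between the local subproblems *)

(** The optimality relation of Fenchel-Rockafellar duality, for arbitrary
    solutions of the two problems.  A subgradient q0 of the perturbation
    function at 0 is a dual point whose value is at most minus the primal
    optimal value, hence so is the value at phat.  Bounding the two conjugates
    at phat from below with the points v and B uhat then shows that uhat
    minimizes F + s + phat o B. *)
Lemma grad_primal_dual {W : normedModType R} {G : W -> \bar R}
    {B : bounded_op V W} {s : dual V} {Phi : V -> R} {k : R} {uhat : V}
    {phat : dual W} :
  (forall v, Phi v = F v + s v + k) -> proper_function G ->
  qualified Phi G B ->
  argmin (fun v => ((Phi v)%:E + G (B v))%E) uhat ->
  argmin (fun q : dual W =>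
    (conjugate (EFin \o F) (- adjoint B q - s)%R + conjugate G q)%E) phat ->
  grad F uhat = - adjoint B phat - s.
Proof.
move=> PhiE [GNy _] [q0 [hfin hsub]] uhat_min phat_min.
have h0E : perturbation Phi G B 0 = ((Phi uhat)%:E + G (B uhat))%E.
  apply/le_anti/andP; split.
    by apply: ereal_inf_lbound; exists uhat => //; rewrite addr0.
  by apply: le_ereal_inf_tmp => _ [v _ <-]; rewrite addr0.
have Gu_fin : G (B uhat) \is a fin_num.
  by move: hfin; rewrite h0E fin_numD => /andP[].
set g := fine (G (B uhat)).
have GuE : G (B uhat) = g%:E by rewrite fineK.
(* the subgradient inequality at the perturbation that moves B v to z *)
have weak v z :
    ((Phi uhat + g + (q0 z - q0 (B v)))%:E <= (Phi v)%:E + G z)%E.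
  have := hsub (z - B v); rewrite h0E GuE subr0 -EFinD.
  rewrite [q0 _]dual_addr dual_oppr => /le_trans; apply.
  by apply: ereal_inf_lbound; exists v => //; rewrite [B v + _]addrC subrK.
have [w wE] := grad_surjective F_sm (- adjoint B q0 - s).
have dual_ub : (conjugate (EFin \o F) (- adjoint B q0 - s)%R + conjugate G q0
    <= (k - Phi uhat - g)%R%:E)%E.
  rewrite -wE conjugate_grad -leeBrDl// -EFinB.
  apply: ge_ereal_sup => _ [z _ <-].
  have := weak w z; have := GNy z.
  case: (G z) => [c| |] //= _; last by rewrite leNye.
  rewrite -EFinB -EFinD !lee_fin !PhiE wE.
  by rewrite !(dualD, dualN) -[adjoint B q0 w]/(q0 (B w)); lra.
apply: grad_minimizer => v.
have := le_trans (phat_min q0) dual_ub.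
have Gphat : ((phat (B uhat) - g)%:E <= conjugate G phat)%E.
  by apply: ereal_sup_ubound; exists (B uhat) => //; rewrite GuE.
move=> /(le_trans (leeD (conjugate_ge _ v) Gphat)).
rewrite -EFinD lee_fin !PhiE !(dualD, dualN) -[adjoint B phat v]/(phat (B v)).
by rewrite -[adjoint B phat uhat]/(phat (B uhat)); lra.
Qed.

End strongly_convex_function.

(** * The two splitting methods *)

Section methods.
Context {R : realType} {V : hilbertType R} {J : nat} {W : 'I_J -> hilbertType R}.
Context {F : V -> R} {G : forall j, W j -> \bar R}.
Context {B : forall j, bounded_op V (W j)} {tau : R}.

(** A dualization requires the primal method to produce at least one sequence.
    The minimizers are chosen beforehand, as a function of the current state and
    of the index j, and the sequence iterates the resulting map on states. *)
Lemma DR_method_nonempty (c : V * ('I_J -> dual V)) :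
  (forall j u r, argmin (dr_local F G B j u r) !=set0) ->
  DR_method F G B tau c !=set0.
Proof.
move=> solvable.
have /choice[uhat uhatP] (s : (V * ('I_J -> dual V)) * 'I_J) :
    exists x, argmin (dr_local F G B s.2 s.1.1 (s.1.2 s.2)) x.
  exact: solvable.
pose r' s j := s.2 j + tau *: (grad F (uhat (s, j)) - grad F s.1) : dual V.
pose step s := (grad_conjugate F (\sum_(j < J) r' s j), r' s).
exists (fun n => (iter n step c).1), (fun n => (iter n step c).2); split => // n.
by split => // j; exists (uhat (iter n step c, j)) => //; exact: uhatP (_, j).
Qed.

Hypothesis G_proper : forall j, proper_function (G j).
Hypothesis F_sc : strongly_convex F.
Hypothesis F_sm : smooth F.
Hypothesis qual_local : forall (p : forall j, dual (W j)) (j : 'I_J),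
  qualified
    (dr_local_smooth F
       (grad_conjugate F (- \sum_(i < J) adjoint (B i) (p i)))
       (- adjoint (B j) (p j)))
    (G j) (B j).

(** Here s, the sum of the B_i^* p_i over i != j, is the part of F'(u) that the
    subproblems of index j leave fixed. *)
Lemma local_grad (p : forall j, dual (W j)) (j : 'I_J) (u uhat : V)
    (phat : dual (W j)) :
  u = grad_conjugate F (- \sum_(i < J) adjoint (B i) (p i)) ->
  argmin (dr_local F G B j u (- adjoint (B j) (p j))) uhat ->
  argmin (psc_local F G B p j) phat ->
  grad F uhat - grad F u = adjoint (B j) (p j) - adjoint (B j) phat.
Proof.
move=> uE uhat_min phat_min.
set s := \sum_(i < J | i != j) adjoint (B i) (p i).
have gu : grad F u = - (adjoint (B j) (p j) + s).
  by rewrite uE grad_conjugate_inv// (bigD1 j).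
have -> : grad F uhat = - adjoint (B j) phat - s.
  (* k collects the terms of the Bregman divergence that do not depend on v *)
  apply: (grad_primal_dual F_sc F_sm (k := grad F u u - F u) _ (G_proper j) _
    uhat_min phat_min).
  - move=> v; rewrite /dr_local_smooth /bregman dual_addr dual_oppr gu.
    by rewrite !(dualD, dualN); lra.
  - by rewrite uE; exact: qual_local.
by rewrite gu opprK addrACA addNr addr0 addrC.
Qed.

Lemma parallel_SC_DR (p : nat -> forall j, dual (W j)) (u : nat -> V)
    (r : nat -> 'I_J -> dual V) :
  parallel_SC F G B tau p -> parallel_DR F G B tau u r ->
  u 0%N = grad_conjugate F (- \sum_(j < J) adjoint (B j) (p 0%N j)) ->
  (forall j, r 0%N j = - adjoint (B j) (p 0%N j)) ->
  forall n, u n = grad_conjugate F (- \sum_(j < J) adjoint (B j) (p n j)) /\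
    forall j, r n j = - adjoint (B j) (p n j).
Proof.
move=> SC DR u0 r0; elim=> [//|n [un rn]].
have rS j : r n.+1 j = - adjoint (B j) (p n.+1 j).
  have [phat phat_min ->] := SC n j.
  have [/(_ j)[uhat uhat_min ->] _] := DR n.
  rewrite rn in uhat_min *.
  rewrite (local_grad _ _ _ _ _ un uhat_min phat_min).
  rewrite adjointD !adjointZ scalerBl scale1r scalerBr opprD opprB addrA.
  by rewrite [- _ + _]addrC.
split => //; have [_ ->] := DR n.
by rewrite -sumrN; congr (grad_conjugate F _); exact: eq_bigr.
Qed.

End methods.

Theorem theorem5p7 (R : realType) (V : hilbertType R) (J : nat)
    (W : 'I_J -> hilbertType R) (B : forall j, bounded_op V (W j))
    (G : forall j, W j -> \bar R) (F : V -> R) (tau : R)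
    (G_proper : forall j, proper_function (G j))
    (G_convex : forall j, ereal_convex (G j))
    (G_lsc : forall j, lower_semicontinuous (G j))
    (F_convex : convex_function [set: V] F)
    (F_diff : forall v, differentiable F v)
    (F_strongly_convex : strongly_convex F)
    (F_smooth : smooth F)
    (tau_gt0 : 0 < tau)
    (dr_solvable : forall j u r, argmin (dr_local F G B j u r) !=set0)
    (psc_solvable : forall p j, argmin (psc_local F G B p j) !=set0)
    (* strong duality for (P) and (D) *)
    (qual : qualified_prod F G B)
    (* strong duality for the local subproblems matched by the dualization *)
    (qual_local : forall (p : forall j, dual (W j)) (j : 'I_J),
      qualified
        (dr_local_smooth F
           (grad_conjugate F (- \sum_(i < J) adjoint (B i) (p i)))
           (- adjoint (B j) (p j)))
        (G j) (B j)) :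
  dualization F B (DR_method F G B tau) (PSC_method F G B tau) /\
  (forall (p : nat -> forall j, dual (W j)) (u : nat -> V)
      (r : nat -> 'I_J -> dual V),
    parallel_SC F G B tau p ->
    parallel_DR F G B tau u r ->
    u 0%N = grad_conjugate F (- \sum_(j < J) adjoint (B j) (p 0%N j)) ->
    (forall j, r 0%N j = - adjoint (B j) (p 0%N j)) ->
    forall n, (0 < n)%N ->
      u n = grad_conjugate F (- \sum_(j < J) adjoint (B j) (p n j)) /\
      forall j, r n j = - adjoint (B j) (p n j)).
Proof.
have step := @parallel_SC_DR R V J W F G B tau G_proper F_strongly_convex
  F_smooth qual_local.
split; last by move=> p u r SC DR u0 r0 n _; exact: step.
move=> p0.
exists (grad_conjugate F (- \sum_(j < J) adjoint (B j) (p0 j)),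
        fun j => - adjoint (B j) (p0 j)).
split; first exact: DR_method_nonempty.
move=> p u [p0E SC] [r [/= u0E r0E DR]] n _.
have [||-> _] := step p u r SC DR _ _ n; rewrite ?u0E ?r0E ?p0E//.
(* F'(u) is a subgradient of F at u, and here F'(u) is the required functional *)
split=> // w; rewrite /= -EFinD lee_fin.
set q := - _; have := subgradient_le F_strongly_convex (grad_conjugate F q) w.
by rewrite grad_conjugate_inv.
Qed.
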